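(* There are uncountably many isomorphism classes of groups in $\mathcal{T}$, where $\mathcal{T}$ is the collection of all subgroups of $\mathrm{PL}_o(I)$ without transition chains.
   Context: $I=[0,1]$. $\mathrm{PL}_o(I)$ is the group, under composition, of piecewise linear orientation-preserving homeomorphisms of $I$ with finitely many breakpoints. An orbital of $f\in \mathrm{PL}_o(I)$ is a maximal (open) interval contained in $\mathrm{Supp}(f)=\{x\in I : (x)f\neq x\}$. A signed orbital of a group $G\le \mathrm{PL}_o(I)$ is a pair $(A,f)$ with $f\in G$ and $A$ an orbital of $f$. A transition chain is a pair of signed orbitals $(A,f),(B,g)$ with $A\cap B\neq\emptyset$, $A\nsubseteq B$ and $B\nsubseteq A$. $G$ has no transition chains if no pair of signed orbitals of $G$ is a transition chain. *)

(* Defs.v *)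
From HB Require Import structures.
From mathcomp Require Import all_boot all_order all_algebra.
From mathcomp Require Import all_classical all_reals all_analysis.
Set Implicit Arguments.
Unset Strict Implicit.
Unset Printing Implicit Defensive.
Import Order.TTheory GRing.Theory Num.Theory.
Import numFieldNormedType.Exports.
Local Open Scope classical_set_scope.
Local Open Scope ring_scope.

(* [set_type] carries the subspace topology of [0, 1]. *)
Notation unitI R := (set_type (`[0, 1]%classic : set R)).

Definition homeomorphism (T U : topologicalType) (f : T -> U) : Prop :=
  continuous f /\ exists g : U -> T, [/\ continuous g, cancel f g & cancel g f].

Section PLo.
Variable R : realType.
Implicit Types (f g : unitI R -> unitI R) (x y u v : unitI R).

Definition orientation_preserving f : Prop :=
  forall x y, val x < val y -> val (f x) < val (f y).

(* [s] lists the breakpoints (possibly with superfluous points). *)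
Definition piecewise_linear f : Prop :=
  exists s : seq R, forall u v,
    (forall c, c \in s -> ~~ (val u < c < val v)) ->
    exists a b : R, forall x,
      val u <= val x <= val v -> val (f x) = a * val x + b.

Definition PLo_homeo : set (unitI R -> unitI R) :=
  [set f | [/\ homeomorphism f, orientation_preserving f & piecewise_linear f]].

Lemma orientation_preserving_le f x y :
  orientation_preserving f -> val x <= val y -> val (f x) <= val (f y).
Proof.
move=> fo; rewrite le_eqVlt => /orP[/eqP/val_inj ->//|/fo/ltW//].
Qed.

Lemma orientation_preserving_inv f g :
  orientation_preserving f -> cancel g f -> orientation_preserving g.
Proof.
move=> fo gK x y xy; rewrite ltNge; apply/negP => /(orientation_preserving_le fo).
by rewrite !gK leNgt xy.
Qed.

Lemma piecewise_linear_comp f g : orientation_preserving f ->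
  bijective f -> piecewise_linear f -> piecewise_linear g ->
  piecewise_linear (g \o f).
Proof.
move=> fo [h fK hK] [s Hs] [t Ht].
have ho := orientation_preserving_inv fo hK.
exists (s ++ [seq (if insub c is Some z then val (h z) else 0) | c <- t]) => u v uv.
have [a [b E1]] : exists a b : R, forall x,
    val u <= val x <= val v -> val (f x) = a * val x + b.
  by apply: Hs => c cs; apply: uv; rewrite mem_cat cs.
have [a' [b' E2]] : exists a b : R, forall x,
    val (f u) <= val x <= val (f v) -> val (g x) = a * val x + b.
  apply: Ht => c ct; apply/negP => /andP[uc cv].
  have cI : c \in (`[0, 1]%classic : set R).
    rewrite inE /= in_itv /=; apply/andP; split.
      apply: le_trans (ltW uc).
      by have := valP (f u); rewrite inE /= in_itv /= => /andP[].
    apply: le_trans (ltW cv) _.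
    by have := valP (f v); rewrite inE /= in_itv /= => /andP[].
  apply: (negP (uv (val (h (Sub c cI))) _)).
    rewrite mem_cat; apply/orP; right; apply/mapP; exists c => //.
    by rewrite insubT.
  rewrite -[u]fK -[v]fK.
  by apply/andP; split; apply: ho; rewrite SubK.
exists (a' * a), (a' * b + b') => x /andP[ux xv].
rewrite /= E2 ?orientation_preserving_le // E1 ?ux //.
by rewrite mulrDr mulrA addrA.
Qed.

Lemma piecewise_linear_inv f g : orientation_preserving f ->
  cancel f g -> cancel g f -> piecewise_linear f -> piecewise_linear g.
Proof.
move=> fo fK gK [s Hs].
have go := orientation_preserving_inv fo gK.
exists [seq (if insub c is Some z then val (f z) else 0) | c <- s] => u v uv.
have [a [b E]] : exists a b : R, forall x,
    val (g u) <= val x <= val (g v) -> val (f x) = a * val x + b.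
  apply: Hs => c cs; apply/negP => /andP[uc cv].
  have cI : c \in (`[0, 1]%classic : set R).
    rewrite inE /= in_itv /=; apply/andP; split.
      apply: le_trans (ltW uc).
      by have := valP (g u); rewrite inE /= in_itv /= => /andP[].
    apply: le_trans (ltW cv) _.
    by have := valP (g v); rewrite inE /= in_itv /= => /andP[].
  apply: (negP (uv (val (f (Sub c cI))) _)).
    by apply/mapP; exists c => //; rewrite insubT.
  rewrite -[u]gK -[v]gK.
  by apply/andP; split; apply: fo; rewrite SubK.
have [a0|a0] := eqVneq a 0.
  exists 0, (val (g u)) => x /andP[ux xv]; rewrite mul0r add0r.
  congr val; apply: (can_inj fK); apply: val_inj.
  by rewrite !E ?lexx ?a0 ?mul0r // !orientation_preserving_le ?(le_trans ux xv).
exists a^-1, (- (a^-1 * b)) => x /andP[ux xv].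
have := E (g x); rewrite gK !orientation_preserving_le // => ->//.
by rewrite mulrDr mulrA mulVf // mul1r addrK.
Qed.

Definition PLo : Type := set_type PLo_homeo.
HB.instance Definition _ := Choice.on PLo.
Definition PLo_fun (f : PLo) : unitI R -> unitI R := set_val f.
Coercion PLo_fun : PLo >-> Funclass.

Lemma PLo_homeo_id : PLo_homeo id.
Proof.
have idc : continuous (id : unitI R -> unitI R) by move=> x; exact: cvg_id.
split=> //; first by split=> //; exists id; split.
by exists [::] => u v _; exists 1, 0 => x _; rewrite mul1r addr0.
Qed.

Lemma PLo_homeo_comp f g : PLo_homeo f -> PLo_homeo g -> PLo_homeo (g \o f).
Proof.
move=> [[fc [f' [f'c fK f'K]]] fo fp] [[gc [g' [g'c gK g'K]]] go gp]; split.
- split; first by move=> x; apply: continuous_comp; [exact: fc|exact: gc].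
  exists (f' \o g'); split; [|exact: can_comp|exact: can_comp].
  by move=> x; apply: continuous_comp; [exact: g'c|exact: f'c].
- by move=> x y /fo/go.
- by apply: piecewise_linear_comp => //; exists f'.
Qed.

Lemma PLo_homeo_inv (f : PLo) :
  exists g, [/\ PLo_homeo g, cancel f g & cancel g f].
Proof.
have : PLo_homeo f by exact: set_valP.
move=> [[fc [g [gc fK gK]]] fo fp]; exists g; split=> //; split.
- by split=> //; exists f.
- exact: orientation_preserving_inv gK.
- exact: piecewise_linear_inv fp.
Qed.

Definition PLo_one : PLo := SigSub (mem_set PLo_homeo_id).
(* Right actions: (x)(f g) = ((x)f)g. *)
Definition PLo_mul (f g : PLo) : PLo :=
  SigSub (mem_set (PLo_homeo_comp (set_valP f) (set_valP g))).
Definition PLo_inv (f : PLo) : PLo :=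
  let: exist g (And3 gP _ _) := cid (PLo_homeo_inv f) in SigSub (mem_set gP).

Lemma PLo_invK (f : PLo) : cancel f (PLo_inv f) /\ cancel (PLo_inv f) f.
Proof. by rewrite /PLo_inv; case: cid => g []. Qed.

Lemma PLo_mulA : associative PLo_mul.
Proof. by move=> f g h; apply: val_inj. Qed.
Lemma PLo_mul1 : left_id PLo_one PLo_mul.
Proof. by move=> f; apply: val_inj. Qed.
Lemma PLo_mulr1 : right_id PLo_one PLo_mul.
Proof. by move=> f; apply: val_inj. Qed.
Lemma PLo_mulV : left_inverse PLo_one PLo_inv PLo_mul.
Proof. by move=> f; apply: val_inj; apply/funext => x; exact: (PLo_invK f).2. Qed.
Lemma PLo_mulrV : right_inverse PLo_one PLo_inv PLo_mul.
Proof. by move=> f; apply: val_inj; apply/funext => x; exact: (PLo_invK f).1. Qed.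

HB.instance Definition _ :=
  isGroup.Build PLo PLo_mulA PLo_mul1 PLo_mulr1 PLo_mulV PLo_mulrV.

Lemma PLo_mulE (f g : PLo) : PLo_fun (f * g)%g = g \o f.
Proof. by []. Qed.

End PLo.

Section TransitionChains.
Variable R : realType.
Implicit Types (f g : PLo R) (G H : set (PLo R)) (A B : set R).

Definition Supp f : set R := val @` [set x : unitI R | f x <> x].

(* Openness of [A] follows from maximality, since [Supp f] is open. *)
Definition orbital f A : Prop :=
  [/\ A !=set0, is_interval A, A `<=` Supp f &
      forall B, is_interval B -> B `<=` Supp f -> A `<=` B -> B = A].

Definition signed_orbital G (p : set R * PLo R) : Prop :=
  G p.2 /\ orbital p.2 p.1.

Definition transition_chain (p q : set R * PLo R) : Prop :=
  [/\ p.1 `&` q.1 !=set0, ~ (p.1 `<=` q.1) & ~ (q.1 `<=` p.1)].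

Definition no_transition_chains G : Prop :=
  forall p q, signed_orbital G p -> signed_orbital G q -> ~ transition_chain p q.

Definition calT : set (set (PLo R)) :=
  [set G | group_closed [in G] /\ no_transition_chains G].

Definition isomorphic G H : Prop :=
  exists phi : PLo R -> PLo R,
    set_bij G H phi /\ {in G &, {morph phi : f g / (f * g)%g}}.

Definition iso_class G : set (set (PLo R)) := [set H | calT H /\ isomorphic G H].

Definition iso_classes : set (set (set (PLo R))) := iso_class @` calT.

End TransitionChains.

Arguments calT R : clear implicits.
Arguments iso_classes R : clear implicits.

(* Main.v *)
Require Import Defs.
From mathcomp Require Import all_boot all_order all_algebra.
From mathcomp Require Import all_classical all_reals all_analysis.
From mathcomp Require Import lra zify.
Set Implicit Arguments.
Unset Strict Implicit.
Unset Printing Implicit Defensive.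
Import Order.TTheory GRing.Theory Num.Theory.
Import numFieldNormedType.Exports.
Local Open Scope classical_set_scope.
Local Open Scope ring_scope.

(* Let f be a one-bump function with orbital (0, 1), and g_0, g_1, ... one-bump
   functions whose orbitals are disjoint and lie in a fundamental domain of f.
   They generate a copy of the wreath product of a countable direct sum of Z by
   Z; its elements have (0, 1) or intervals from the disjoint family of all
   f^i-translates of the orbitals of the g_n as orbitals, so that none of its
   subgroups has a transition chain.  Fix distinct primes q_n and for a set S of
   naturals let G_S be generated by f and by g_n^(q_n), [g_n, f] for n in S.
   Its base group is the direct sum over n in S of the ideals
   {a | q_n divides a(1)} of Z[t, 1/t], whose coinvariants are Z + Z/q_n, the
   torsion being generated by [g_n, f]; the map detecting it is a |-> a'(1)
   mod q_n.  Hence the abelianization of G_S has q_n-torsion exactly when n is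
   in S, and the uncountably many sets S give pairwise non-isomorphic groups. *)

(** * Generated subgroups, derived subgroups and torsion of the abelianization *)

Section DerivedSubgroup.
Local Open Scope group_scope.
Variable G : groupType.
Implicit Types (x y z a : G) (A X : set G) (i j : int).

Definition zexp x i : G :=
  match i with Posz n => x ^+ n | Negz n => x ^- n.+1 end.

Lemma zexpS x i : zexp x (i + 1)%R = zexp x i * x.
Proof.
case: i => [n|[|n]].
- have -> : (Posz n + 1)%R = n.+1 by lia.
  by rewrite /= expgSr.
- have -> : (Negz 0 + 1)%R = 0%R by lia.
  by rewrite /= expg1 mulVg.
have -> : (Negz n.+1 + 1)%R = Negz n by lia.
by rewrite /= (expgS x n.+1) invgM mulgVK.
Qed.

Lemma zexpB1 x i : zexp x (i - 1)%R = zexp x i * x^-1.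
Proof. by rewrite -[in RHS](subrK 1%R i) zexpS mulgK. Qed.

Lemma zexpD x i j : zexp x (i + j)%R = zexp x i * zexp x j.
Proof.
elim: j => [|n IH|n IH]; first by rewrite addr0 mulg1.
- by rewrite intS (addrC 1%R) addrA !zexpS IH mulgA.
- by rewrite intS opprD (addrC (-1)%R) addrA !zexpB1 IH mulgA.
Qed.

Lemma zexpN x i : zexp x (- i)%R = (zexp x i)^-1.
Proof. by apply/esym/mulg1_eq; rewrite -zexpD subrr. Qed.

Lemma zexpnM x n i : zexp x (n%:Z * i)%R = zexp (x ^+ n) i.
Proof.
case: i => m; first exact: expgnA.
by rewrite NegzE mulrN !zexpN; congr (_^-1); exact: expgnA.
Qed.

Inductive gen X : set G :=
| gen_in x : X x -> gen X x
| gen_one : gen X 1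
| gen_mul x y : gen X x -> gen X y -> gen X (x * y)
| gen_inv x : gen X x -> gen X x^-1.

Inductive der A : set G :=
| der_in x y : A x -> A y -> der A [~ x, y]
| der_one : der A 1
| der_mul x y : der A x -> der A y -> der A (x * y).

(** For [p] prime this says that the abelianization of [A] has an element of order [p], phrased
    without forming the quotient. *)
Definition derived_torsion p A : Prop :=
  exists x, [/\ A x, ~ der A x & der A (x ^+ p)].

Definition subgroup A : Prop :=
  [/\ A 1, forall x y, A x -> A y -> A (x * y) & forall x, A x -> A x^-1].

Lemma subgroup_gen X : subgroup (gen X).
Proof. by split; [exact: gen_one|exact: gen_mul|exact: gen_inv]. Qed.

Lemma gen_sub X A : subgroup A -> X `<=` A -> gen X `<=` A.
Proof.
move=> [A1 AM AV] XA x; elim=> {x} [x /XA//|//|x y _ Ax _|x _]; first exact: AM.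
exact: AV.
Qed.

Lemma gen_mono X Y : X `<=` Y -> gen X `<=` gen Y.
Proof. by move=> XY; apply: gen_sub (subgroup_gen _) _ => x /XY; apply: gen_in. Qed.

Lemma zexp_gen X x i : gen X x -> gen X (zexp x i).
Proof.
have XX n y : gen X y -> gen X (y ^+ n).
  move=> Xy; elim: n => [|n IH]; first exact: gen_one.
  by rewrite expgS; apply: gen_mul.
by case: i => n Xx /=; [exact: XX|apply/gen_inv/XX].
Qed.

Lemma derV A x : der A x -> der A x^-1.
Proof.
elim=> {x} [x y Ax Ay||x y _ Ax _ Ay]; first by rewrite invgR; apply: der_in.
  by rewrite invg1; apply: der_one.
by rewrite invgM; apply: der_mul.
Qed.

Lemma derX A x n : der A x -> der A (x ^+ n).
Proof.
move=> Ax; elim: n => [|n IH]; first exact: der_one.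
by rewrite expgS; apply: der_mul.
Qed.

Section Mod.
Variable A : set G.
Hypothesis Agrp : subgroup A.

Lemma der_sub : der A `<=` A.
Proof.
case: Agrp => A1 AM AV x.
elim=> {x} [x y Ax Ay|//|x y _ Ax _ Ay]; last exact: AM.
by rewrite commgEl conjgE; apply: (AM); [exact: AV|apply: (AM); [exact: AV|exact: AM]].
Qed.

Lemma derJ x y : der A x -> A y -> der A (x ^ y).
Proof.
case: Agrp => A1 AM AV Ax Ay; elim: Ax => {x} [u v Au Av||u v _ Au _ Av].
- have AJ w : A w -> A (w ^ y) by move=> Aw; rewrite conjgE; apply: (AM); [exact: AV|exact: AM].
  by rewrite conjRg; apply: der_in; apply: AJ.
- by rewrite conj1g; apply: der_one.
by rewrite conjMg; apply: der_mul.
Qed.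

(** Equality of images in the abelianization of [A]. *)
Definition eqder x y : Prop := der A (x^-1 * y).

Lemma eqder_refl x : eqder x x.
Proof. by rewrite /eqder mulVg; apply: der_one. Qed.

Lemma eqder_trans x y z : eqder x y -> eqder y z -> eqder x z.
Proof. by move=> xy yz; have := der_mul xy yz; rewrite mulgA mulgK. Qed.

Lemma eqderM x y u v : A u -> eqder x y -> eqder u v -> eqder (x * u) (y * v).
Proof.
move=> Au xy uv; have := der_mul (derJ xy Au) uv; congr der.
by rewrite conjgE invgM !mulgA mulgK.
Qed.

Lemma eqderC x y : A x -> A y -> eqder (x * y) (y * x).
Proof.
move=> Ax Ay; have := der_in Ay Ax.
by rewrite /eqder commgEl conjgE invgM !mulgA.
Qed.

Lemma eqderV x y : A x -> A y -> eqder x y -> eqder x^-1 y^-1.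
Proof.
move=> Ax Ay xy; have [_ _ AV] := Agrp.
have := derJ (derV xy) (AV _ Ay).
by rewrite /eqder conjgE !invgM !invgK !mulgA mulgV mul1g.
Qed.

Lemma eqder_der x y : eqder x y -> der A y -> der A x.
Proof.
move=> xy Ay; have := der_mul Ay (derV xy).
by rewrite invgM invgK mulgA mulgV mul1g.
Qed.

(** In the abelianization all occurrences of [a] in a word can be collected at its right end. This
    allows generators to be split off one at a time. *)
Lemma gen_setU1 X a x : X `<=` A -> A a -> gen (X `|` [set a]) x ->
  exists y i, gen X y /\ eqder x (y * zexp a i).
Proof.
move=> XA Aa; have [A1 AM AV] := Agrp.
have gA := gen_sub Agrp XA.
have zA i : A (zexp a i).
  apply: (@gen_sub [set a] A) => //; first by move=> _ ->.
  by apply: zexp_gen; apply: gen_in.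
elim=> {x} [x [Xx|->]||x y _ [u [i [Xu xu]]] _ [v [j [Xv yv]]]|x Xx [u [i [Xu xu]]]].
- by exists x, 0%R; split; [exact: gen_in|rewrite mulg1; apply: eqder_refl].
- exists 1, 1%R; split; first exact: gen_one.
  by rewrite mul1g /= expg1; apply: eqder_refl.
- exists 1, 0%R; split; first exact: gen_one.
  by rewrite mulg1; apply: eqder_refl.
- exists (u * v), (i + j)%R; split; first exact: gen_mul.
  have Ay : A y.
    have := AM _ _ (AM _ _ (gA _ Xv) (zA j)) (AV _ (der_sub yv)).
    by rewrite invgM invgK mulgA mulgV mul1g.
  apply: eqder_trans (eqderM Ay xu yv) _.
  rewrite zexpD -!mulgA; apply: eqderM (eqder_refl _) _; first by apply: (AM) => //; apply: (AM) => //; exact: gA.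
  rewrite !mulgA; apply: eqderM (zA _) (eqderC _ _) (eqder_refl _) => //.
  exact: gA.
exists u^-1, (- i)%R; split; first exact: gen_inv.
have Axu : A (u * zexp a i) by apply: (AM) => //; apply: gA.
have Ax : A x.
  by have := AM _ _ Axu (AV _ (der_sub xu)); rewrite invgM invgK mulgA mulgV mul1g.
apply: eqder_trans (eqderV Ax Axu xu) _.
by rewrite invgM zexpN; apply: eqderC; [exact/AV/zA|exact/AV/gA].
Qed.

End Mod.

(** As [phi] is multiplicative on [A] only, each use of it on a word needs the letters to lie in
    [A]. *)
Lemma derived_torsion_iso p A B (phi : G -> G) : subgroup A -> subgroup B ->
  set_bij A B phi -> {in A &, {morph phi : x y / x * y}} ->
  derived_torsion p A -> derived_torsion p B.
Proof.
move=> Agrp Bgrp [AB inj surj] phiM [x [Ax Nx Dx]].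
have [A1 AM AV] := Agrp.
have pM u v : A u -> A v -> phi (u * v) = phi u * phi v.
  by move=> Au Av; apply: phiM; rewrite inE.
have p1 : phi 1 = 1 by apply: (@mulgI _ (phi 1)); rewrite -pM // !mulg1.
have pV u : A u -> phi u^-1 = (phi u)^-1.
  by move=> Au; apply/esym/mulg1_eq; rewrite -pM ?mulgV //; exact: AV.
have pR u v : A u -> A v -> phi [~ u, v] = [~ phi u, phi v].
  move=> Au Av; rewrite !commgEl !conjgE !pM ?pV //; [exact: AV|exact: AM|exact: AV|].
  by apply: (AM); [exact: AV|exact: AM].
have pX u n : A u -> A (u ^+ n) /\ phi (u ^+ n) = phi u ^+ n.
  move=> Au; elim: n => [|n [Aun IH]]; first by rewrite !expg0.
  by rewrite !expgS; split; [exact: AM|rewrite pM // IH].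
have pd u : der A u -> der B (phi u).
  elim=> {u} [u v Au Av||u v Du IHu Dv IHv].
  - by rewrite pR //; apply: der_in; apply: AB.
  - by rewrite p1; apply: der_one.
  - by rewrite pM; [exact: der_mul|exact: der_sub Du|exact: der_sub Dv].
(* Lifting derived elements, together with injectivity on [A], keeps the image of [x] outside the
   derived subgroup of [B]. *)
have dp w : der B w -> exists2 u, der A u & phi u = w.
  elim=> {w} [_ _ /surj[u Au <-] /surj[v Av <-]||_ _ _ [u Du <-] _ [v Dv <-]].
  - by exists [~ u, v]; [exact: der_in|rewrite pR].
  - by exists 1; [exact: der_one|].
  - by exists (u * v); [exact: der_mul|rewrite pM //; [exact: der_sub Du|exact: der_sub Dv]].
exists (phi x); split; [exact: AB| |by rewrite -(pX _ _ Ax).2; apply: pd].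
move=> /dp[u Du]; have Au := der_sub Agrp Du.
by move=> /inj ux; apply: Nx; rewrite -ux ?inE.
Qed.

End DerivedSubgroup.

(** * One-bump functions as elements of the group of PL homeomorphisms *)

Section Bump.
Variable R : realType.
Implicit Types (a b t : R) (x y u v : unitI R).

Lemma unitI_bounds x : 0 <= val x <= 1.
Proof. by have := valP x; rewrite inE /= in_itv. Qed.

(* Outside [a, b] this is the identity; on [a, b] the slope is 2, then 1/2. *)
Definition bump_fun a b t := Num.max t (Num.min (2 * t - a) ((t + b) / 2)).
Definition bump_inv a b t := Num.min t (Num.max ((t + a) / 2) (2 * t - b)).

(** Splits on the innermost comparisons first, until each goal is linear arithmetic. *)
Ltac pl_cases := rewrite /bump_fun /bump_inv ?maxEle ?minEle;
  repeat match goal with |- context [if (?x <= ?y)%R then _ else _] =>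
    lazymatch constr:((x, y)) with
    | context [if _ then _ else _] => fail
    | _ => case: (lerP x y) => ?
    end
  end.

Lemma bump_funK a b : a < b -> cancel (bump_fun a b) (bump_inv a b).
Proof. by move=> ab t; pl_cases; lra. Qed.

Lemma bump_invK a b : a < b -> cancel (bump_inv a b) (bump_fun a b).
Proof. by move=> ab t; pl_cases; lra. Qed.

Lemma bump_fun_id a b t : a < b -> ~~ (a < t < b) -> bump_fun a b t = t.
Proof.
by move=> ab; rewrite negb_and -!leNgt => /orP[] ?; pl_cases; lra.
Qed.

Lemma bump_fun_left a b t : a <= t <= a + (b - a) / 3 -> bump_fun a b t = 2 * t - a.
Proof. by move=> /andP[? ?]; pl_cases; lra. Qed.

Lemma bump_fun_right a b t : a + (b - a) / 3 <= t <= b -> bump_fun a b t = (t + b) / 2.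
Proof. by move=> /andP[? ?]; pl_cases; lra. Qed.

Lemma bump_fun_in a b t : a < t < b -> t < bump_fun a b t < b.
Proof. by move=> /andP[? ?]; pl_cases; lra. Qed.

Lemma bump_inv_unit a b t : 0 <= a -> a < b -> b <= 1 ->
  0 <= t <= 1 -> bump_inv a b t \in (`[0, 1]%classic : set R).
Proof.
move=> a0 ab b1 /andP[t0 t1]; rewrite inE /= in_itv /=.
by pl_cases; lra.
Qed.

Lemma bump_fun_unit a b t : 0 <= a -> a < b -> b <= 1 ->
  0 <= t <= 1 -> bump_fun a b t \in (`[0, 1]%classic : set R).
Proof.
move=> a0 ab b1 /andP[t0 t1]; rewrite inE /= in_itv /=.
by pl_cases; lra.
Qed.

Lemma bump_fun_continuous a b : continuous (bump_fun a b).
Proof.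
move=> t; apply: (@continuous_max _ R^o id); first exact: cvg_id.
apply: (@continuous_min _ R^o (fun t => 2 * t - a)).
  by apply: cvgB; [apply: cvgM; [exact: cvg_cst|exact: cvg_id]|exact: cvg_cst].
by apply: cvgM; [apply: cvgD; [exact: cvg_id|exact: cvg_cst]|exact: cvg_cst].
Qed.

Lemma bump_inv_continuous a b : continuous (bump_inv a b).
Proof.
move=> t; apply: (@continuous_min _ R^o id); first exact: cvg_id.
apply: (@continuous_max _ R^o (fun t => (t + a) / 2)).
  by apply: cvgM; [apply: cvgD; [exact: cvg_id|exact: cvg_cst]|exact: cvg_cst].
by apply: cvgB; [apply: cvgM; [exact: cvg_cst|exact: cvg_id]|exact: cvg_cst].
Qed.

Lemma lift_continuous (F : R -> R)
    (FI : forall x, F (val x) \in (`[0, 1]%classic : set R)) :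
  continuous F -> continuous (fun x => SigSub (FI x) : unitI R).
Proof.
move=> Fc; apply: continuous_comp_initial => x.
apply: (@continuous_comp _ _ _ (val : unitI R -> R) F); last exact: Fc.
exact: initial_continuous.
Qed.

Section BumpHomeo.
Variables a b : R.
Hypotheses (a0 : 0 <= a) (ab : a < b) (b1 : b <= 1).

Definition bump x : unitI R := SigSub (bump_fun_unit a0 ab b1 (unitI_bounds x)).

Lemma PLo_homeo_bump : PLo_homeo bump.
Proof.
split.
- split; first by apply: lift_continuous; exact: bump_fun_continuous.
  exists (fun x => SigSub (bump_inv_unit a0 ab b1 (unitI_bounds x))); split.
  + by apply: lift_continuous; exact: bump_inv_continuous.
  + by move=> x; apply: val_inj; rewrite /= bump_funK.
  + by move=> x; apply: val_inj; rewrite /= bump_invK.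
- move=> x y; rewrite /= => xy.
  by pl_cases; lra.
(* [a + (b - a) / 3] is where the slope changes from 2 to 1/2. *)
exists [:: a; a + (b - a) / 3; b] => u v uv.
have [ua um ub] : [/\ ~~ (val u < a < val v),
    ~~ (val u < a + (b - a) / 3 < val v) & ~~ (val u < b < val v)].
  by split; apply: uv; rewrite !inE eqxx ?orbT.
have H (p q : R) : (forall x, val u <= val x <= val v -> bump_fun a b (val x) = p * val x + q) ->
    exists p q : R, forall x, val u <= val x <= val v -> val (bump x) = p * val x + q.
  by exists p, q.
rewrite !negb_and -!leNgt in ua um ub.
(* No breakpoint lies strictly between [u] and [v], so the points between them are all left of [a],
   all right of [b], or all in one of the two pieces of slope 2 and 1/2. *)
have [va|va] := leP (val v) a.
  apply: (H 1 0) => x /andP[ux xv]; rewrite mul1r addr0 bump_fun_id //.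
  by rewrite [a < _]ltNge (le_trans xv va).
have [vb|vb] := leP b (val u).
  apply: (H 1 0) => x /andP[ux xv]; rewrite mul1r addr0 bump_fun_id //.
  by rewrite [_ < b]ltNge (le_trans vb ux) andbF.
have {}ua : a <= val u by move: ua; rewrite [_ <= a]leNgt va orbF.
have {}ub : val v <= b by move: ub; rewrite [b <= _]leNgt vb.
have [vm|vm] := leP (val v) (a + (b - a) / 3).
  apply: (H 2 (- a)) => x /andP[ux xv]; rewrite bump_fun_left //.
  by rewrite (le_trans ua ux) (le_trans xv vm).
have {}um : a + (b - a) / 3 <= val u by move: um; rewrite [_ <= a + _]leNgt vm orbF.
apply: (H (1 / 2) (b / 2)) => x /andP[ux xv]; rewrite bump_fun_right.
  by rewrite mul1r mulrDl mulrC.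
by rewrite (le_trans um ux) (le_trans xv ub).
Qed.

Definition PLo_bump : PLo R := SigSub (mem_set PLo_homeo_bump).

Lemma PLo_bumpE x : val (PLo_bump x) = bump_fun a b (val x).
Proof. by []. Qed.

End BumpHomeo.
End Bump.

(** * Dynamics of powers of bumps, and the choice of the generators *)

Local Notation pow h i := (PLo_fun (zexp h i)).

Section Dynamics.
Variable R : realType.
Implicit Types (h : PLo R) (x y z : unitI R) (i j k : int).

Lemma PLo_mono h x y : val x < val y -> val (h x) < val (h y).
Proof. by case: (set_valP h) => _ ho _; exact: ho. Qed.

Lemma PLo_inj h : injective h.
Proof. exact: can_inj (PLo_invK h).1. Qed.

Lemma zexp1 h : zexp h 1 = h.
Proof. by rewrite /= expg1. Qed.

Lemma PLo_zexpD h i j x : pow h (i + j) x = pow h j (pow h i x).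
Proof. by rewrite zexpD PLo_mulE. Qed.

Lemma PLo_zexpK h i x : pow h (- i) (pow h i x) = x.
Proof. by rewrite -PLo_zexpD subrr. Qed.

Lemma PLo_zexpVK h i x : pow h i (pow h (- i) x) = x.
Proof. by rewrite -PLo_zexpD addNr. Qed.

(** Endpoints are fixed: if [x] is 0 and [y] is its preimage, then [x] is at most [y], so [h x] is
    at most [h y = x], the minimum. The case of 1 is symmetric. *)
Lemma PLo_moved_interior h x : h x <> x -> 0 < val x < 1.
Proof.
have bounds := @unitI_bounds R; move=> hx.
have [y yx] : exists y, h y = x by exists (PLo_inv h x); exact: (PLo_invK h).2.
apply/andP; split; rewrite lt_neqAle; apply/andP; split.
- apply/eqP => x0; apply: hx; apply: val_inj.
  have /andP[y0 _] := bounds y; have /andP[hx0 _] := bounds (h x).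
  have xy : val x <= val y by rewrite -x0.
  move: xy; rewrite le_eqVlt => /orP[/eqP/val_inj e|/(PLo_mono h)].
    by rewrite {1}e yx.
  by rewrite yx -x0 ltNge hx0.
- by have /andP[] := bounds x.
- apply/eqP => x1; apply: hx; apply: val_inj.
  have /andP[_ y1] := bounds y; have /andP[_ hx1] := bounds (h x).
  have xy : val y <= val x by rewrite x1.
  move: xy; rewrite le_eqVlt => /orP[/eqP/val_inj e|/(PLo_mono h)].
    by rewrite -{1}e yx.
  by rewrite yx x1 ltNge hx1.
- by have /andP[] := bounds x.
Qed.

Section BumpPowers.
Variables a b : R.
Hypotheses (a0 : 0 <= a) (ab : a < b) (b1 : b <= 1).
Let g := PLo_bump a0 ab b1.

Lemma bump_zexp_fix i x : ~~ (a < val x < b) -> pow g i x = x.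
Proof.
move=> xab; have gx : g x = x by apply: val_inj; rewrite PLo_bumpE bump_fun_id.
have gX n : PLo_fun (g ^+ n)%g x = x.
  by elim: n => // n IH; rewrite expgS PLo_mulE /= gx.
case: i => n; first exact: gX.
by rewrite NegzE -{1}(gX n.+1); exact: (PLo_zexpK g n.+1).
Qed.

Lemma bump_zexp_in i x : (a < val (pow g i x) < b) = (a < val x < b).
Proof.
have H j y : a < val y < b -> a < val (pow g j y) < b.
  move=> yab; apply/negPn/negP => nab; have := bump_zexp_fix (- j) nab.
  by rewrite PLo_zexpK => e; move: nab; rewrite -e yab.
by apply/idP/idP => [/(H (- i))|/H //]; rewrite PLo_zexpK.
Qed.

(** Positive powers move the points of the orbital strictly to the right; a point fixed by a
    negative power is fixed by the opposite positive one. *)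
Lemma bump_zexp_move i x : a < val x < b -> i != 0 -> pow g i x <> x.
Proof.
move=> xab.
have pos n : val x < val (pow g n.+1 x).
  elim: n => [|n IH].
    by rewrite zexp1 PLo_bumpE; have /andP[] := bump_fun_in xab.
  apply: lt_trans IH _.
  have -> : n.+2%:Z = n.+1%:Z + 1 by lia.
  rewrite PLo_zexpD zexp1 PLo_bumpE.
  by have /andP[] := bump_fun_in (etrans (bump_zexp_in n.+1 x) xab).
case: i => [[//|n]|n] _ e; first by have := pos n; rewrite e ltxx.
have := pos n; rewrite -{2}e NegzE PLo_zexpVK ltxx.
by [].
Qed.

End BumpPowers.

(** The intervals from [lft n] to [rgt n] abut one another and accumulate at 1/3. They stay between
    1/3 and its image 2/3 under [shift], hence in a fundamental domain. *)
Definition lft n : R := 1 / 3 + 1 / 3 * n.+3%:R^-1.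
Definition rgt n : R := 1 / 3 + 1 / 3 * n.+2%:R^-1.

Lemma lft_gt n : 1 / 3 < lft n.
Proof. by rewrite /lft ltrDl mulr_gt0 ?invr_gt0 ?ltr0n //; lra. Qed.

Lemma lft_lt_rgt n : lft n < rgt n.
Proof.
rewrite /lft /rgt ltrD2l ltr_pM2l; last by lra.
by rewrite ltf_pV2 ?posrE ?ltr0n // ltr_nat.
Qed.

Lemma rgt_lt n : rgt n < 2 / 3.
Proof.
have : n.+2%:R^-1 <= 2%:R^-1 :> R by rewrite lef_pV2 ?posrE ?ltr0n // ler_nat.
by rewrite /rgt; set t := n.+2%:R^-1; lra.
Qed.

Lemma rgt_le_lft m n : (m < n)%N -> rgt n <= lft m.
Proof.
move=> mn; rewrite /lft /rgt lerD2l ler_pM2l; last by lra.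
by rewrite lef_pV2 ?posrE ?ltr0n // ler_nat; lia.
Qed.

Lemma lft_ge0 n : 0 <= lft n.
Proof. by have := lft_gt n; lra. Qed.

Lemma rgt_le1 n : rgt n <= 1.
Proof. by have := rgt_lt n; lra. Qed.

Definition shift : PLo R := PLo_bump (lexx 0) ltr01 (lexx 1).
Definition bmp n : PLo R := PLo_bump (lft_ge0 n) (lft_lt_rgt n) (rgt_le1 n).
Definition cell n : set (unitI R) := [set x | lft n < val x < rgt n].

Definition in_window x := 1 / 3 < val x < 2 / 3.

Lemma cell_window n x : cell n x -> in_window x.
Proof.
by move=> /andP[? ?]; have := lft_gt n; have := rgt_lt n; rewrite /in_window; lra.
Qed.

Lemma cell_disjoint m n x : cell m x -> cell n x -> m = n.
Proof.
move=> /andP[lx xr] /andP[lx' xr']; case: (ltngtP m n) => // /rgt_le_lft le.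
  by have := lt_trans (lt_le_trans xr' le) lx; rewrite ltxx.
by have := lt_trans (lt_le_trans xr le) lx'; rewrite ltxx.
Qed.

(** The shift carries every point above 1/3 beyond 2/3, so each positive power pushes the window off
    itself and distinct translates are disjoint. *)
Lemma window_shift x y i j : in_window x -> in_window y ->
  pow shift i x = pow shift j y -> i = j /\ x = y.
Proof.
have far n z : in_window z -> 2 / 3 < val (pow shift n.+1 z).
  have step w : 1 / 3 < val w -> 2 / 3 < val (shift w).
    rewrite PLo_bumpE => w3; have /andP[_ w1] := unitI_bounds w.
    by rewrite bump_fun_right; lra.
  move=> /andP[z1 _]; elim: n => [|n IH]; first by rewrite zexp1; exact: step.
  have -> : n.+2%:Z = n.+1%:Z + 1 by lia.
  by rewrite PLo_zexpD zexp1; apply: step; lra.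
have lt u v k l : in_window u -> in_window v ->
    pow shift k u = pow shift l v -> ~ k < l.
  move=> wu wv e kl; have [n nE] : exists n : nat, l - k = n.+1.
    by exists (absz (l - k)).-1; lia.
  have := far n v wv; rewrite -nE PLo_zexpD -e PLo_zexpK.
  by case/andP: wu; lra.
move=> wx wy e; have ij : i = j.
  by have := lt _ _ _ _ wx wy e; have := lt _ _ _ _ wy wx (esym e); lia.
by split=> //; move: e; rewrite ij => /PLo_inj.
Qed.

End Dynamics.

(** * The action of the wreath product, its orbitals, and the absence of transition chains *)

Section Wreath.
Variable R : realType.
Notation shift := (shift R).
Notation bmp := (bmp R).
Notation cell := (@cell R).
Implicit Types (h : PLo R) (x y z : unitI R) (i j k : int) (c : nat -> int -> int).

Lemma cell_pow n i x : cell n x -> cell n (pow (bmp n) i x).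
Proof. by rewrite /cell /= bump_zexp_in. Qed.

Lemma bmp_fix n i x : ~ cell n x -> pow (bmp n) i x = x.
Proof. by move=> /negP nx; apply: bump_zexp_fix. Qed.

Lemma bmp_eq n i j x : cell n x -> pow (bmp n) i x = pow (bmp n) j x -> i = j.
Proof.
move=> nx e; apply/eqP; rewrite -subr_eq0; apply/negPn/negP => ij.
apply: (@bump_zexp_move _ _ _ (lft_ge0 R n) (lft_lt_rgt R n) (rgt_le1 R n) _ _ nx ij).
by rewrite -[LHS]/(pow (bmp n) (i - j) x) PLo_zexpD e -PLo_zexpD subrr.
Qed.

Lemma cell_inhabited n : exists x, cell n x.
Proof.
have lr := lft_lt_rgt R n; have l := lft_gt R n; have r := rgt_lt R n.
have mI : (lft R n + rgt R n) / 2 \in (`[0, 1]%classic : set R).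
  rewrite inE /= in_itv /=; move: lr l r; move: (lft R n) (rgt R n) => p q; lra.
exists (SigSub mI); rewrite /cell /=; move: lr; move: (lft R n) (rgt R n) => p q; lra.
Qed.

Definition in_cells y : Prop := exists n i x, cell n x /\ y = pow shift i x.

(* [h] is the element [(c, k)] of the wreath product of the direct sum of the
   groups [<bmp n>] with [<shift>]. *)
Definition acts h k c : Prop :=
  (forall n i x, cell n x ->
     h (pow shift i x) = pow shift (i + k) (pow (bmp n) (c n i) x)) /\
  (forall y, ~ in_cells y -> h y = pow shift k y).

Lemma in_cells_shift k y : in_cells (pow shift k y) -> in_cells y.
Proof.
move=> [n [i [x [nx e]]]]; exists n, (i - k), x; split=> //.
by rewrite PLo_zexpD -e PLo_zexpK.
Qed.

Lemma acts_one : acts 1%g 0 (fun _ _ => 0).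
Proof. by split=> [n i x _|y _]; rewrite ?addr0. Qed.

(** Products act from left to right: [h] takes the translate of index [i] to index [i + k], and
    there [h'] reads its exponent. *)
Lemma acts_mul h h' k k' c c' : acts h k c -> acts h' k' c' ->
  acts (h * h')%g (k + k') (fun n i => c n i + c' n (i + k)).
Proof.
move=> [hc h0] [hc' h0']; split=> [n i x nx|y ny]; rewrite PLo_mulE /=.
  rewrite (hc n) // (hc' n); last exact: cell_pow.
  by rewrite addrA [in RHS]PLo_zexpD.
rewrite h0 // h0' ?PLo_zexpD //.
by move=> /in_cells_shift.
Qed.

Lemma acts_inv h k c : acts h k c -> acts h^-1%g (- k) (fun n i => - c n (i - k)).
Proof.
move=> [hc h0]; have hV x y : h x = y -> PLo_fun h^-1%g y = x.
  by move=> <-; exact: (PLo_invK h).1.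
split=> [n i x nx|y ny]; apply: hV.
  by rewrite (hc n) ?subrK ?PLo_zexpVK //; exact: cell_pow.
rewrite h0 ?PLo_zexpVK //.
by move=> /in_cells_shift.
Qed.

Lemma acts_shift : acts shift 1 (fun _ _ => 0).
Proof. by split=> [n i x _|y _]; rewrite ?PLo_zexpD zexp1. Qed.

Lemma acts_bmp m : acts (bmp m) 0 (fun n i => ((n == m) && (i == 0))%:Z).
Proof.
split=> [n i x nx|y ny].
  rewrite addr0; have [->|i0] := eqVneq i 0; rewrite ?andbT ?andbF.
    have [<-|nm] := eqVneq n m; first by rewrite zexp1.
    rewrite -[LHS]/(bmp m x) -[RHS]/x -(zexp1 (bmp m)) bmp_fix // => mx.
    by move/eqP: nm; apply; exact: cell_disjoint nx mx.
  rewrite -[RHS]/(pow shift i x) -(zexp1 (bmp m)) bmp_fix // => mx.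
  have := window_shift (cell_window nx) (cell_window mx) (j := 0) (i := i) erefl.
  by case=> i0'; rewrite i0' in i0.
rewrite -[RHS]/y -(zexp1 (bmp m)) bmp_fix // => my.
by apply: ny; exists m, 0, y.
Qed.

Lemma acts_inj h k k' c c' : acts h k c -> acts h k' c' ->
  k = k' /\ forall n i, c n i = c' n i.
Proof.
move=> [hc _] [hc' _].
have H n i : k = k' /\ c n i = c' n i.
  have [x nx] := cell_inhabited n; have := hc _ i _ nx; rewrite (hc' n) // => e.
  have w j : in_window (pow (bmp n) j x) by apply: cell_window (cell_pow _ nx).
  have [ik e'] := window_shift (w _) (w _) e.
  by split; [move: ik; lia|apply: (bmp_eq nx)].
by split=> [|n i]; [exact: (H 0%N 0).1|exact: (H n i).2].
Qed.


Lemma unitI_point (t : R) : 0 <= t <= 1 -> exists x, val x = t.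
Proof.
move=> t01; have tI : t \in (`[0, 1]%classic : set R) by rewrite inE /= in_itv.
by exists (SigSub tI).
Qed.

(** By disjointness an endpoint of one open cell lies in no other cell. Elements with [k = 0]
    therefore fix all endpoints of translated cells, which bounds their orbitals. *)
Lemma endpoint_notin_cells n i x : val x = lft R n \/ val x = rgt R n ->
  ~ in_cells (pow shift i x).
Proof.
have ln := lft_gt R n; have rn := rgt_lt R n; have lr := lft_lt_rgt R n.
move=> xE [m [j [y [my e]]]].
have wx : in_window x.
  rewrite /in_window; case: xE => ->.
    by rewrite ln (lt_trans lr rn).
  by rewrite (lt_trans ln lr) rn.
have [_ xy] := window_shift wx (cell_window my) e.
move: my; rewrite -xy => /andP[lx xr].
case: (ltngtP m n) => [/(rgt_le_lft R) le|/(rgt_le_lft R) le|mn].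
- have := le_lt_trans le lx; case: xE => ->; last by rewrite ltxx.
  by move=> /(lt_trans lr); rewrite ltxx.
- have := lt_le_trans xr le; case: xE => ->; first by rewrite ltxx.
  by move=> /lt_trans/(_ lr); rewrite ltxx.
- by move: lx xr; rewrite mn; case: xE => ->; rewrite ltxx.
Qed.

Definition span n i : set R := val @` (pow shift i @` cell n).

Lemma spanE n i x y : val x = lft R n -> val y = rgt R n ->
  span n i = [set t | val (pow shift i x) < t < val (pow shift i y)].
Proof.
move=> xl yr; apply/seteqP; split=> t /=.
  move=> [_ [z /andP[lz zr] <-] <-].
  by rewrite !PLo_mono ?xl ?yr.
move=> /andP[xt ty].
have [z zt] : exists z, val z = t.
  apply: unitI_point; have /andP[x0 _] := unitI_bounds (pow shift i x).
  have /andP[_ y1] := unitI_bounds (pow shift i y).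
  by rewrite (le_trans x0 (ltW xt)) (le_trans (ltW ty) y1).
exists z => //; exists (pow shift (- i) z); last by rewrite PLo_zexpVK.
rewrite -zt in xt ty; apply/andP; rewrite -xl -yr.
by split; [rewrite -(PLo_zexpK shift i x)|rewrite -(PLo_zexpK shift i y)];
  apply: PLo_mono.
Qed.

(** For [k = 0] the element preserves each translated cell, acting there as a conjugate of a bump
    power, and is trivial elsewhere. For [k] nonzero it moves every interior point. *)
Lemma acts_orbital h k c A : acts h k c -> orbital h A ->
  A = `]0, 1[%classic \/ exists n i, A = span n i.
Proof.
move=> [hc h0] [[t At] Aitv Asub Amax].
have [k0|k0] := eqVneq k 0.
  right; have [z hz zt] := Asub _ At.
  have [n [i [x [nx zE]]]] : in_cells z.
    by apply: contrapT => nz; apply: hz; rewrite h0 // k0.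
  have spant : span n i t by exists z => //; exists x.
  have cn : c n i <> 0 by move=> c0; apply: hz; rewrite zE (hc n) // c0 k0 addr0.
  have spanS : span n i `<=` Supp h.
    move=> _ [_ [w nw <-] <-]; exists (pow shift i w) => //=.
    rewrite (hc n) // k0 addr0 => /PLo_inj e; apply: cn.
    exact: (bmp_eq nw (j := 0) e).
  have lI : 0 <= lft R n <= 1.
    by rewrite lft_ge0 (le_trans (ltW (lft_lt_rgt R n)) (rgt_le1 R n)).
  have rI : 0 <= rgt R n <= 1.
    by rewrite rgt_le1 (le_trans (lft_ge0 R n) (ltW (lft_lt_rgt R n))).
  have [l lE] := unitI_point lI; have [r rE] := unitI_point rI.
  (* An interval of moved points through [t] cannot cross the fixed ends of the translated cell
     containing [t]. *)
  have fixend w : val w = lft R n \/ val w = rgt R n -> ~ A (val (pow shift i w)).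
    move=> /(@endpoint_notin_cells _ i) nw /Asub[v hv /val_inj vw]; apply: hv.
    by rewrite vw h0 // k0.
  have sE := spanE i lE rE.
  move: (spant); rewrite sE /= => /andP[lt tr].
  exists n, i; apply/esym/Amax => //.
    move=> p q; rewrite sE /= => /andP[lp _] /andP[_ qr] s /andP[ps sq].
    by rewrite (lt_le_trans lp ps) (le_lt_trans sq qr).
  move=> s As; rewrite sE /=; apply/andP; split; rewrite ltNge; apply/negP => ls.
    apply: (fixend l); first by left.
    by apply: (Aitv s t) => //; rewrite ls (ltW lt).
  apply: (fixend r); first by right.
  by apply: (Aitv t s) => //; rewrite ls (ltW tr).
left; apply/esym/Amax.
- exact: interval_is_interval.
- move=> s; rewrite /= in_itv /= => /andP[s0 s1].
  have [z zs] : exists z, val z = s by apply: unitI_point; rewrite !ltW.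
  exists z => //= hz.
  (* A point of a translated cell goes to a different translate; any other point moves as under a
     nontrivial power of [shift]. *)
  have [[n [i [x [nx zE]]]]|nz] := pselect (in_cells z).
    move: hz; rewrite zE (hc n) // => e.
    have [] := window_shift (cell_window (cell_pow _ nx)) (cell_window nx) e.
    by move: k0; lia.
  have z01 : 0 < val z < 1 by rewrite zs s0.
  by apply: (@bump_zexp_move _ _ _ (lexx 0) ltr01 (lexx 1) _ _ z01 k0); rewrite -[RHS]hz h0.
- by move=> s /Asub[z /PLo_moved_interior z01 <-]; rewrite /= in_itv.
Qed.

Lemma span_unit n i : span n i `<=` `]0, 1[%classic.
Proof.
move=> _ [_ [x /cell_window/andP[x0 x1] <-] <-]; rewrite /= in_itv /=.
by rewrite (@bump_zexp_in R _ _ (lexx 0) ltr01 (lexx 1)); lra.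
Qed.

Lemma span_meet n m i j : span n i `&` span m j !=set0 -> span n i = span m j.
Proof.
move=> [_ [[_ [x nx <-] <-] [_ [y my <-] /val_inj e]]].
have [ij xy] := window_shift (cell_window my) (cell_window nx) e.
by rewrite ij (cell_disjoint nx (m := n) (n := m)) // -xy.
Qed.

(** Two translated cells are equal or disjoint, and all lie in the unit interval, so intersecting
    orbitals are nested. *)
Lemma acts_no_transition_chains (G : set (PLo R)) :
  (forall h, G h -> exists k c, acts h k c) -> no_transition_chains G.
Proof.
move=> GW [A f] [B g] [/GW[k [c fa]] /= fA] [/GW[k' [c' ga]] /= gB] [/= AB /= AnB /= BnA].
case: (acts_orbital fa fA) => [AE|[n [i AE]]]; last first.
  case: (acts_orbital ga gB) => [BE|[m [j BE]]].
    by apply: AnB; rewrite AE BE; exact: span_unit.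
  by apply: AnB; rewrite AE BE (span_meet (n := n) (m := m) (i := i) (j := j)) // -AE -BE.
apply: BnA; rewrite AE.
by case: (acts_orbital ga gB) => [->//|[m [j ->]]]; exact: span_unit.
Qed.

End Wreath.

(** * Heisenberg-type invariants of elements of the wreath product *)

Section Heisenberg.
Variable R : realType.
Notation shift := (shift R).
Notation bmp := (bmp R).
Implicit Types (h x y : PLo R) (i k : int) (s r : nat -> int) (D : int -> int).

Definition diff2 D i := D (i + 1) - 2 * D i + D (i - 1).

Definition asymp D (s r : int) : Prop := exists N : nat,
  (forall i, i <= - N%:Z -> D i = 0) /\ (forall i, N%:Z <= i -> D i = i * s + r).

(* If [c n] has finite support and [D] is its second antidifference vanishing
   near [-oo], then [D i = i * s + r] near [+oo] where [s] is the sum of the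
   [c n i] and [r] that of the [- i * c n i]. *)
Definition has_code h k s r : Prop := exists D : nat -> int -> int,
  acts h k (fun n => diff2 (D n)) /\ forall n, asymp (D n) (s n) (r n).

Lemma code_one : has_code 1%g 0 (fun=> 0) (fun=> 0).
Proof.
exists (fun _ _ => 0); split; first exact: acts_one.
by move=> n; exists 0%N; split=> // i _; lia.
Qed.

(* The triples [(k, s n, r n)] multiply as in the integral Heisenberg group. *)
Lemma code_mul h h' k k' s s' r r' : has_code h k s r -> has_code h' k' s' r' ->
  has_code (h * h')%g (k + k') (fun n => s n + s' n)
    (fun n => r n + r' n + k * s' n).
Proof.
move=> [D [hD aD]] [D' [hD' aD']].
exists (fun n i => D n i + D' n (i + k)); split.
  have := acts_mul hD hD'; congr acts; apply/funext => n; apply/funext => i.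
  rewrite /diff2.
  have -> : i + 1 + k = i + k + 1 by lia.
  have -> : i - 1 + k = i + k - 1 by lia.
  lia.
move=> n; have [N [N0 N1]] := aD n; have [N' [N0' N1']] := aD' n.
(* [D'] is evaluated at [i + k], which moves its threshold by at most the absolute value of [k] and
   adds [k * s'] to the constant term. *)
exists (N + N' + absz k)%N; split=> i iN.
  by rewrite N0 ?N0' //; lia.
by rewrite N1 ?N1' //; lia.
Qed.

Lemma code_inv h k s r : has_code h k s r ->
  has_code h^-1%g (- k) (fun n => - s n) (fun n => - r n + k * s n).
Proof.
move=> [D [hD aD]]; exists (fun n i => - D n (i - k)); split.
  have := acts_inv hD; congr acts; apply/funext => n; apply/funext => i.
  rewrite /diff2.
  have -> : i + 1 - k = i - k + 1 by lia.
  have -> : i - 1 - k = i - k - 1 by lia.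
  lia.
move=> n; have [N [N0 N1]] := aD n.
exists (N + absz k)%N; split=> i iN.
  by rewrite N0 //; lia.
by rewrite N1 //; lia.
Qed.

Lemma code_shift : has_code shift 1 (fun=> 0) (fun=> 0).
Proof.
exists (fun _ _ => 0); split; first exact: acts_shift.
by move=> n; exists 0%N; split=> // i _; lia.
Qed.

Lemma code_bmp m : has_code (bmp m) 0 (fun n => (n == m)%:Z) (fun=> 0).
Proof.
(* The ramp max(i, 0) has the indicator of 0 as its second difference. *)
exists (fun n i => if (n == m) && (0 < i) then i else 0); split.
  have := acts_bmp R m; congr acts; apply/funext => n; apply/funext => i.
  rewrite /diff2; case: (n == m) => //=.
  by do 3 case: ltP => ?; case: eqP => ?; lia.
move=> n; exists 0%N; split=> i i0; first by rewrite ltNge i0 andbF.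
case: (n == m) => /=; last by lia.
by case: ltP => ?; lia.
Qed.

(** The recurrence determines each value from the two before it, so zeros propagate rightwards. *)
Lemma diff2_eq0 D : (forall i, diff2 D i = 0) ->
  (exists N : nat, forall i, i <= - N%:Z -> D i = 0) -> forall i, D i = 0.
Proof.
move=> D0 [N N0].
have H (m : nat) : forall i, i <= - N%:Z + m%:Z -> D i = 0.
  elim: m => [|m IH] i im; first by apply: N0; lia.
  have := D0 (i - 1); rewrite /diff2 subrK (IH (i - 1)) ?(IH (i - 1 - 1)); lia.
by move=> i; apply: (H (absz i + N)%N); lia.
Qed.

Lemma code_inj h k k' s s' r r' : has_code h k s r -> has_code h k' s' r' ->
  [/\ k = k', s = s' & r = r'].
Proof.
move=> [D [hD aD]] [D' [hD' aD']]; have [kk' DD'] := acts_inj hD hD'.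
suff sr n : s n = s' n /\ r n = r' n.
  by split=> //; apply/funext => n; have [] := sr n.
have [N [N0 N1]] := aD n; have [N' [N0' N1']] := aD' n.
have E0 i : D n i - D' n i = 0.
  move: i; apply: (@diff2_eq0 (fun i => D n i - D' n i)).
    by move=> i; have := DD' n i; rewrite /diff2; lia.
  by exists (N + N')%N => i iN; rewrite N0 ?N0' //; lia.
(* Two consecutive arguments beyond both thresholds determine slope and intercept. *)
have e1 := E0 (N + N')%N; have e2 := E0 (N + N').+1.
have d1 := N1 (N + N')%N; have d2 := N1 (N + N').+1.
have d1' := N1' (N + N')%N; have d2' := N1' (N + N').+1.
lia.
Qed.

Lemma acts_ext h h' k c : acts h k c -> acts h' k c -> h = h'.
Proof.
move=> [hc h0] [hc' h0']; apply: val_inj; apply/funext => y.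
rewrite -[LHS]/(PLo_fun h y) -[RHS]/(PLo_fun h' y).
have [[n [i [x [nx ->]]]]|ny] := pselect (in_cells y); last by rewrite h0 // h0'.
by rewrite (hc n) // (hc' n).
Qed.

Definition wreath : set (PLo R) :=
  [set h | exists k s r, has_code h k s r].

Definition codes h : set (int * (nat -> int) * (nat -> int)) :=
  [set t | has_code h t.1.1 t.1.2 t.2].
(** By [code_inj] the choice is forced on [wreath]; elsewhere the zero triple is a default value. *)
Definition code h := xget (0, fun=> 0, fun=> 0) (codes h).
Definition kcode h := (code h).1.1.
Definition scode h n := (code h).1.2 n.
Definition rcode h n := (code h).2 n.

Lemma codeE h k s r : has_code h k s r ->
  [/\ kcode h = k, scode h = s & rcode h = r].
Proof.
move=> hk; have : codes h (code h) by exact: (@xgetPex _ _ (codes h) (ex_intro _ (k, s, r) hk)).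
by move=> /code_inj/(_ hk) [].
Qed.

Lemma has_codeP h : wreath h -> has_code h (kcode h) (scode h) (rcode h).
Proof. by move=> [k [s [r hk]]]; have [-> -> ->] := codeE hk. Qed.

Lemma subgroup_wreath : subgroup wreath.
Proof.
split=> [|x y [k [s [r xk]]] [k' [s' [r' yk]]]|x [k [s [r xk]]]].
- by do 3 eexists; exact: code_one.
- by do 3 eexists; exact: code_mul xk yk.
- by do 3 eexists; exact: code_inv xk.
Qed.

Lemma code1 : [/\ kcode 1%g = 0, scode 1%g = fun=> 0 & rcode 1%g = fun=> 0].
Proof. exact: codeE code_one. Qed.

Lemma codeM x y : wreath x -> wreath y ->
  [/\ kcode (x * y)%g = kcode x + kcode y,
      forall n, scode (x * y)%g n = scode x n + scode y n &
      forall n, rcode (x * y)%g n = rcode x n + rcode y n + kcode x * scode y n].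
Proof.
move=> /has_codeP xk /has_codeP yk.
by have [-> -> ->] := codeE (code_mul xk yk).
Qed.

Lemma codeV x : wreath x ->
  [/\ kcode x^-1%g = - kcode x, forall n, scode x^-1%g n = - scode x n &
      forall n, rcode x^-1%g n = - rcode x n + kcode x * scode x n].
Proof. by move=> /has_codeP xk; have [-> -> ->] := codeE (code_inv xk). Qed.

Lemma wreath_zexp x i : wreath x -> wreath (zexp x i).
Proof.
move=> wx; apply: (@gen_sub _ [set x]); first exact: subgroup_wreath.
  by move=> _ ->.
by apply: zexp_gen; apply: gen_in.
Qed.

(** The condition [kcode x = 0] removes the cross term of the product, which would make the last
    component quadratic in [i]. *)
Lemma code_zexp x i : wreath x ->
  [/\ kcode (zexp x i) = i * kcode x, forall n, scode (zexp x i) n = i * scode x n &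
      kcode x = 0 -> forall n, rcode (zexp x i) n = i * rcode x n].
Proof.
move=> wx; elim: i => [|m [IHk IHs IHr]|m [IHk IHs IHr]].
- by have [/= -> -> ->] := code1; split=> *; lia.
- rewrite intS addrC zexpS; have wm := wreath_zexp m wx.
  have [-> sE rE] := codeM wm wx; split=> [|n|k0 n]; first by rewrite IHk; lia.
    by rewrite sE IHs; lia.
  by rewrite rE IHr // IHk k0; lia.
rewrite intS opprD addrC zexpB1.
have wm := wreath_zexp (- m%:Z) wx; have [_ _ wV] := subgroup_wreath.
have [-> sE rE] := codeM wm (wV _ wx); have [kV sV rV] := codeV wx.
split=> [|n|k0 n]; first by rewrite IHk kV; lia.
  by rewrite sE IHs sV; lia.
by rewrite rE IHr // IHk rV sV k0; lia.
Qed.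

Lemma code_expg x p : wreath x ->
  [/\ kcode (x ^+ p)%g = p%:Z * kcode x,
      forall n, scode (x ^+ p)%g n = p%:Z * scode x n &
      kcode x = 0 -> forall n, rcode (x ^+ p)%g n = p%:Z * rcode x n].
Proof. exact: (@code_zexp x p). Qed.

(** As in the Heisenberg group, a commutator has a central code, given by the determinant of the
    [(k, s)] parts. *)
Lemma code_comm x y : wreath x -> wreath y ->
  [/\ kcode [~ x, y]%g = 0, forall n, scode [~ x, y]%g n = 0 &
      forall n, rcode [~ x, y]%g n = kcode x * scode y n - kcode y * scode x n].
Proof.
move=> wx wy; have [_ wM wV] := subgroup_wreath.
have [kx sx rx] := codeV wx; have [ky sy ry] := codeV wy.
rewrite commgEl conjgE.
have [k1 s1 r1] := codeM wx wy.
have [k2 s2 r2] := codeM (wV _ wy) (wM _ _ wx wy).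
have [k3 s3 r3] := codeM (wV _ wx) (wM _ _ (wV _ wy) (wM _ _ wx wy)).
split=> [|n|n].
- by rewrite k3 kx k2 ky k1; lia.
- by rewrite s3 sx s2 sy s1; lia.
- by rewrite r3 rx kx r2 s2 ry sy ky r1 s1; lia.
Qed.

Lemma wreath_commute x y : wreath x -> wreath y -> kcode x = 0 -> kcode y = 0 ->
  commute x y.
Proof.
move=> /has_codeP[D [xD _]] /has_codeP[D' [yD _]] kx ky.
have xy := acts_mul xD yD; have yx := acts_mul yD xD.
rewrite /commute; apply: acts_ext xy _; rewrite kx ky in yx *.
by move: yx; congr acts; apply/funext => n; apply/funext => i; rewrite !addr0 addrC.
Qed.

End Heisenberg.

(** * Distinct primes, the groups attached to sets of naturals, and their torsion *)

Definition prime_seq n : nat := iter n (fun m => s2val (prime_above m)) 2%N.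

Lemma prime_seqP n : prime (prime_seq n).
Proof. by case: n => // n; exact: s2valP' (prime_above _). Qed.

Lemma prime_seq_inj : injective prime_seq.
Proof.
have mono : {homo prime_seq : m n / (m < n)%N}.
  by apply: homo_ltn; [exact: ltn_trans|move=> n; exact: s2valP (prime_above _)].
by move=> m n e; case: (ltngtP m n) => // /mono; rewrite e ltnn.
Qed.

Section Groups.
Variable R : realType.
Notation shift := (shift R).
Notation bmp := (bmp R).
Notation wreath := (@wreath R).
Implicit Types (x y : PLo R) (S T : set nat).

Local Notation q n := ((prime_seq n)%:Z).

Definition pow_gen n : PLo R := (bmp n ^+ prime_seq n)%g.
Definition comm_gen n : PLo R := [~ bmp n, shift]%g.

Definition gens S : set (PLo R) :=
  [set x | x = shift \/ exists n, S n /\ (x = pow_gen n \/ x = comm_gen n)].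
Definition grp S : set (PLo R) := gen (gens S).

Lemma wreath_shift : wreath shift.
Proof. by do 3 eexists; exact: code_shift. Qed.

Lemma wreath_bmp n : wreath (bmp n).
Proof. by do 3 eexists; exact: code_bmp. Qed.

Lemma code_shiftE : [/\ kcode shift = 1, scode shift = fun=> 0 & rcode shift = fun=> 0].
Proof. exact: codeE (code_shift R). Qed.

Lemma code_pow_gen m : [/\ wreath (pow_gen m), kcode (pow_gen m) = 0,
  forall n, scode (pow_gen m) n = if n == m then q m else 0 &
  forall n, rcode (pow_gen m) n = 0].
Proof.
have [k s r] := codeE (code_bmp R m).
have [kX sX rX] := code_expg (prime_seq m) (wreath_bmp m).
split.
- exact: (@wreath_zexp _ _ (q m) (wreath_bmp m)).
- by rewrite kX k mulr0.
- by move=> n; rewrite sX s; case: (n == m); lia.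
- by move=> n; rewrite rX // r mulr0.
Qed.

Lemma code_comm_gen m : [/\ wreath (comm_gen m), kcode (comm_gen m) = 0,
  forall n, scode (comm_gen m) n = 0 &
  forall n, rcode (comm_gen m) n = - (n == m)%:Z].
Proof.
have [k s r] := codeE (code_bmp R m); have [ks ss rs] := code_shiftE.
have [kc sc rc] := code_comm (wreath_bmp m) wreath_shift.
have [W1 WM WV] := subgroup_wreath R.
split=> //.
  by rewrite /comm_gen commgEl conjgE; apply: (WM); [|apply: (WM); [|apply: (WM)]];
    [apply: WV| apply: WV| |]; solve [exact: wreath_bmp|exact: wreath_shift].
by move=> n; rewrite rc k s ks ss mul0r sub0r mul1r.
Qed.

Lemma subgroup_grp S : subgroup (grp S).
Proof. exact: subgroup_gen. Qed.

Lemma gens_sub S A : A shift ->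
  (forall n, S n -> A (pow_gen n)) -> (forall n, S n -> A (comm_gen n)) ->
  gens S `<=` A.
Proof. by move=> As Ap Ac x [->//|[n [Sn [->|->]]]]; [exact: Ap|exact: Ac]. Qed.

Lemma grp_wreath S : grp S `<=` wreath.
Proof.
apply: gen_sub; first exact: subgroup_wreath.
apply: gens_sub => [|n _|n _]; first exact: wreath_shift.
  by case: (code_pow_gen n).
by case: (code_comm_gen n).
Qed.

(** [scode] is additive, and among the generators only [pow_gen n] contributes at [n], by exactly
    [q n]. *)
Lemma grp_scode S x n : grp S x -> (q n %| scode x n)%Z.
Proof.
suff : grp S `<=` [set x | wreath x /\ (q n %| scode x n)%Z] by move=> H /H[].
have [W1 WM WV] := subgroup_wreath R.
apply: gen_sub.
  split=> [|u v [Wu du] [Wv dv]|u [Wu du]]; rewrite /mkset.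
  - by have [_ -> _] := code1 R; split=> //; exact: dvdz0.
  - by have [_ -> _] := codeM Wu Wv; split; [exact: WM|exact: rpredD].
  - by have [_ -> _] := codeV Wu; split; [exact: WV|rewrite rpredN].
apply: gens_sub => [|m _|m _].
- by have [_ sE _] := code_shiftE; split; [exact: wreath_shift|rewrite sE dvdz0].
- have [W _ sE _] := code_pow_gen m; split=> //; rewrite sE.
  by case: eqP => [->|_]; rewrite ?dvdzz ?dvdz0.
- by have [W _ sE _] := code_comm_gen m; split; rewrite ?sE ?dvdz0.
Qed.

Lemma grp_code0 S x n : ~ S n -> grp S x -> scode x n = 0 /\ rcode x n = 0.
Proof.
move=> Sn; suff : grp S `<=` [set x | wreath x /\ (scode x n = 0 /\ rcode x n = 0)].
  by move=> H /H[].
have [W1 WM WV] := subgroup_wreath R.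
apply: gen_sub.
  split=> [|u v [Wu [su ru]] [Wv [sv rv]]|u [Wu [su ru]]]; rewrite /mkset.
  - by have [_ -> ->] := code1 R.
  - by have [_ -> ->] := codeM Wu Wv; split; [exact: WM|rewrite su ru sv rv mulr0].
  - by have [_ -> ->] := codeV Wu; split; [exact: WV|rewrite su ru mulr0].
apply: gens_sub => [|m Sm|m Sm].
- by have [_ sE rE] := code_shiftE; split; [exact: wreath_shift|rewrite sE rE].
- have [W _ sE rE] := code_pow_gen m; split=> //; rewrite sE rE.
  by case: eqP => // e; case: Sn; rewrite e.
- have [W _ sE rE] := code_comm_gen m; split=> //; rewrite sE rE.
  by case: eqP => // e; case: Sn; rewrite e.
Qed.

(** The determinant formula for commutators is divisible by [q n] because both [scode] values are.
    Where [scode] vanishes, [rcode] is additive, so divisibility passes to products. *)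
Lemma der_code S x : der (grp S) x -> [/\ wreath x, kcode x = 0,
  forall n, scode x n = 0 & forall n, (q n %| rcode x n)%Z].
Proof.
have [W1 WM WV] := subgroup_wreath R; have GW := @grp_wreath S.
elim=> {x} [x y Gx Gy||x y _ [Wx kx sx rx] _ [Wy ky sy ry]].
- have [k s r] := code_comm (GW _ Gx) (GW _ Gy); split=> //.
    apply: (GW); apply: (der_sub (subgroup_grp S)); exact: der_in.
  by move=> n; rewrite r rpredB // dvdz_mull // (grp_scode _ Gx, grp_scode _ Gy).
- by have [k s r] := code1 R; split=> // n; rewrite ?s ?r ?dvdz0.
have [k s r] := codeM Wx Wy; split=> [||n|n]; first exact: WM.
- by rewrite k kx ky.
- by rewrite s sx sy.
- by rewrite r sy mulr0 addr0 rpredD.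
Qed.

(** Thus [kcode], [scode] and [rcode] modulo the primes are invariants of classes in the
    abelianization. *)
Lemma eqder_code S x y : grp S x -> eqder (grp S) x y -> [/\ kcode y = kcode x,
  forall n, scode y n = scode x n & forall n, (q n %| rcode y n - rcode x n)%Z].
Proof.
move=> Gx /der_code[W k0 s0 r0]; have [k s r] := codeM (grp_wreath Gx) W.
rewrite mulVKg in k s r; split=> [|n|n].
- by rewrite k k0 addr0.
- by rewrite s s0 addr0.
- by rewrite r s0 mulr0 addr0 addrC addKr.
Qed.

(** [comm_gen n] is the product of the commuting elements [(bmp n)^-1] and [bmp n ^ shift], so its
    power is the commutator of the generators [pow_gen n] and [shift]. *)
Lemma comm_gen_der S n : S n -> der (grp S) (comm_gen n ^+ prime_seq n)%g.
Proof.
move=> Sn; have [W1 WM WV] := subgroup_wreath R.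
have [kb _ _] := codeE (code_bmp R n).
have [kbV _ _] := codeV (wreath_bmp n).
have [_ kc _ _] := code_comm_gen n.
have cE : comm_gen n = ((bmp n)^-1 * bmp n ^ shift)%g by rewrite /comm_gen commgEl.
have Wc : wreath (bmp n ^ shift)%g.
  have [Wc _ _ _] := code_comm_gen n.
  have -> : (bmp n ^ shift = bmp n * comm_gen n)%g by rewrite cE mulVKg.
  by apply: (WM) => //; exact: wreath_bmp.
have kJ : kcode (bmp n ^ shift)%g = 0.
  have := kc; rewrite cE; have [-> _ _] := codeM (WV _ (wreath_bmp n)) Wc.
  by rewrite kbV kb oppr0 add0r.
have cm : commute (bmp n)^-1%g (bmp n ^ shift)%g.
  by apply: wreath_commute => //; [exact/WV/wreath_bmp|rewrite kbV kb oppr0].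
rewrite cE expgMn // expVgn -conjXg -commgEl.
apply: der_in; apply: gen_in; last by left.
by right; exists n; split=> //; left.
Qed.

(** A converse of [der_code], by induction on a bound for the indices of the generators in [x].
    Modulo the derived subgroup, [x] is [y] times powers [i] of [pow_gen N] and [j] of [comm_gen N],
    with [y] using smaller indices. The code forces [i = 0] and [q N] to divide [j], so that both
    powers are derived. *)
Lemma kernel_der S N x :
  grp (S `&` [set n | (n < N)%N]) x -> kcode x = 0 ->
  (forall n, S n -> scode x n = 0 /\ (q n %| rcode x n)%Z) -> der (grp S) x.
Proof.
elim: N x => [|N IH] x Gx k0 sr0.
  (* Only the generator [shift] is left, and [kcode] reads off its exponent. *)
  have : range (zexp shift) x.
    move: x Gx {k0 sr0}; apply: gen_sub; last first.
      by apply: gens_sub => [|n []//|n []//]; exists 1 => //; exact: zexp1.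
    split=> [|_ _ [i _ <-] [j _ <-]|_ [i _ <-]]; first by exists 0.
      by exists (i + j) => //; rewrite zexpD.
    by exists (- i) => //; rewrite zexpN.
  move=> [i _ xE]; move: k0; rewrite -xE.
  have [-> _ _] := code_zexp i wreath_shift; have [-> _ _] := code_shiftE.
  by rewrite mulr1 => ->; exact: der_one.
have subN M : grp (S `&` [set n | (n < M)%N]) `<=` grp S.
  apply: gen_mono => y [->|[n [[Sn _] yn]]]; first by left.
  by right; exists n.
have [SN|SN] := pselect (S N); last first.
  apply: IH => //; apply: gen_mono Gx => y [->|[n [[Sn nN] yn]]]; first by left.
  right; exists n; split=> //; split=> //=; move: nN; rewrite /= ltnS leq_eqVlt.
  by case/orP => // /eqP e; case: SN; rewrite -e.
have Ga : grp S (pow_gen N) by apply: gen_in; right; exists N; split=> //; left.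
have Gb : grp S (comm_gen N) by apply: gen_in; right; exists N; split=> //; right.
pose X := gens (S `&` [set n | (n < N)%N]).
have XG : X `<=` grp S by move=> y Xy; apply: (subN N); apply: gen_in.
have XaG : X `|` [set pow_gen N] `<=` grp S by move=> y [/XG//|->].
have Gx' : gen ((X `|` [set pow_gen N]) `|` [set comm_gen N]) x.
  apply: gen_mono Gx => y [->|[n [[Sn nN] yn]]]; first by left; left; left.
  move: nN; rewrite /= ltnS leq_eqVlt => /orP[/eqP e|nN].
    by rewrite e in yn; case: yn => ->; [left; right|right].
  by left; left; right; exists n.
have [y' [j [Gy' xy']]] := gen_setU1 (subgroup_grp S) XaG Gb Gx'.
have [y [i [Gy yy']]] := gen_setU1 (subgroup_grp S) XG Ga Gy'.
have [G1 GM GV] := subgroup_grp S.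
have Gyy := subN _ _ Gy.
have Gzb : grp S (zexp (comm_gen N) j) by apply: zexp_gen.
have Gza : grp S (zexp (pow_gen N) i) by apply: zexp_gen.
have xy := eqder_trans xy' (eqderM (subgroup_grp S) Gzb yy' (eqder_refl _ _)).
have NN : ~ (S `&` [set n | (n < N)%N]) N by move=> [_]; rewrite /= ltnn.
have [sN rN] := grp_code0 NN Gy.
have [_ ka sa ra] := code_pow_gen N; have [_ kb sb rb] := code_comm_gen N.
have [kzb szb rzb] := code_zexp j (grp_wreath Gb).
have [kza sza rza] := code_zexp i (grp_wreath Ga).
have Gya := GM _ _ Gyy Gza.
have [k1 s1 r1] := codeM (grp_wreath Gyy) (grp_wreath Gza).
have [k2 s2 r2] := codeM (grp_wreath Gya) (grp_wreath Gzb).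
have [k3 s3 r3] := eqder_code (subN _ _ Gx) xy.
have ky : kcode y = 0 by move: k3; rewrite k2 k1 kzb kza ka kb k0; lia.
(* At index [N] both [x] and [y] have [scode] zero, which leaves [q N * i = 0]. *)
have i0 : i = 0.
  have := s3 N; rewrite s2 s1 szb sza sb sa eqxx sN (sr0 N SN).1.
  by have := prime_gt0 (prime_seqP N); nia.
have qj : (q N %| j)%Z.
  have := r3 N; rewrite r2 r1 rzb // rza // ra rb eqxx sza szb sb sa rN ky k1 ky.
  rewrite kza ka i0 !(mul0r, mulr0, add0r, addr0) mulrN1 => qr.
  by have := rpredD qr (sr0 N SN).2; rewrite subrK rpredN.
have [j' jE] : exists j', j = q N * j' by move/dvdzP: qj => [j' ->]; exists j'; rewrite mulrC.
apply: eqder_der xy _.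
rewrite i0 jE mulg1 zexpnM; apply: der_mul; last first.
  have dX := comm_gen_der SN.
  by case: (j') => m; [exact: derX|apply/derV/derX].
apply: IH => // n Sn; have [sx rx] := sr0 n Sn.
have sy : scode y n = 0.
  by have := s3 n; rewrite s2 s1 szb sza sb sx i0; lia.
split=> //.
(* For [n] other than [N] the [rcode] values of [x] and [y] agree modulo [q n]; at [N] that of [y]
   is zero. *)
have := r3 n; rewrite r2 r1 rzb // rza // ra rb sza szb sb ky k1 ky kza ka i0.
rewrite !(mul0r, mulr0, add0r, addr0) => qr.
have [nN|nN] := eqVneq n N; first by rewrite nN rN dvdz0.
by have := rpredD qr rx; rewrite subrK (negbTE nN) oppr0 mulr0 addr0.
Qed.

(** For [m] in [S] the torsion element is [comm_gen m], whose [rcode] at [m] is -1. Otherwise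
    [kernel_der] shows that an element whose power is derived is itself derived. *)
Lemma derived_torsion_grp S m : derived_torsion (prime_seq m) (grp S) <-> S m.
Proof.
split=> [[x [Gx Nx Dx]]|Sm]; last first.
  exists (comm_gen m); split.
  - by apply: gen_in; right; exists m; split=> //; right.
  - move=> /der_code[_ _ _ /(_ m)]; have [_ _ _ ->] := code_comm_gen m.
    rewrite eqxx rpredN dvdzE /= dvdn1 => /eqP q1.
    by have := prime_gt1 (prime_seqP m); rewrite q1.
  - exact: comm_gen_der.
apply: contrapT => Sm; apply: Nx.
have [kX sX rX] := code_expg (prime_seq m) (grp_wreath Gx).
have [_ k0 s0 r0] := der_code Dx.
have qm := prime_gt0 (prime_seqP m).
have kx : kcode x = 0 by move: k0; rewrite kX; nia.
(* A word involves finitely many generators, hence bounded indices. *)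
have [N GN] : exists N, grp (S `&` [set n | (n < N)%N]) x.
  have mono M N T : (M <= N)%N ->
      grp (T `&` [set n | (n < M)%N]) `<=` grp (T `&` [set n | (n < N)%N]).
    move=> MN; apply: gen_mono => y [->|[n [[Tn nM] yn]]]; first by left.
    by right; exists n; split=> //; split=> //=; exact: leq_trans nM MN.
  elim: Gx => {x Dx kX sX rX k0 s0 r0 kx} [x [->|[n [Sn xn]]]||x y _ [M xM] _ [N yN]|x _ [N xN]].
  - by exists 0%N; apply: gen_in; left.
  - by exists n.+1; apply: gen_in; right; exists n; split=> //; split=> //=.
  - by exists 0%N; exact: gen_one.
  - exists (maxn M N); apply: gen_mul.
      by apply: (mono M) xM; exact: leq_maxl.
    by apply: (mono N) yN; exact: leq_maxr.
  - by exists N; exact: gen_inv.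
apply: (kernel_der GN) => // n Sn; split.
  by move: (s0 n); rewrite sX; nia.
(* As [m] is not in [S], the primes of index [n] and [m] are distinct, so the factor [q m] can be
   cancelled. *)
have := r0 n; rewrite rX // Gauss_dvdzr // coprimezE /=.
rewrite prime_coprime ?prime_seqP // dvdn_prime2 ?prime_seqP //.
by apply/eqP => /prime_seq_inj nm; apply: Sm; rewrite -nm.
Qed.

Lemma grp_calT S : calT R (grp S).
Proof.
have [G1 GM GV] := subgroup_grp S; split.
  split=> [|x y]; rewrite !inE // => Gx Gy.
  by apply: GM => //; exact: GV.
apply: acts_no_transition_chains => x /grp_wreath[k [s [r [D [xD _]]]]].
by exists k; eexists; exact: xD.
Qed.

(** Each group lies in its own class, so equal classes give an isomorphism, which carries torsion
    over and thereby recovers the set. *)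
Lemma iso_class_grp_inj : injective (fun S => iso_class (grp S)).
Proof.
have H S T : iso_class (grp S) = iso_class (grp T) -> T `<=` S.
  move=> ST; have : iso_class (grp S) (grp S).
    split; first exact: grp_calT.
    by exists id; split=> //; split=> // x Gx; exists x.
  rewrite ST => -[_ [phi [bij phiM]]] n /derived_torsion_grp Tn.
  apply/derived_torsion_grp.
  exact: derived_torsion_iso (subgroup_grp T) (subgroup_grp S) bij phiM Tn.
by move=> S T ST; apply/seteqP; split; apply: H.
Qed.

End Groups.

Theorem corollary1p7 (R : realType) : ~ countable (iso_classes R).
Proof.
move=> /countable_injP[f finj].
pose g (S : set nat) := f (iso_class (@grp R S)).
have ginj : injective g.
  move=> S T /finj ST; apply: (@iso_class_grp_inj R); apply: ST; rewrite inE.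
    by exists (@grp R S) => //; exact: grp_calT.
  by exists (@grp R T) => //; exact: grp_calT.
(* Cantor's diagonal set for the injection [g] from sets of naturals to naturals: asking whether
   [g D] lies in [D] is contradictory. *)
pose D := [set n | exists2 S, g S = n & ~ S n].
have ND : ~ D (g D) by move=> gD; case: (gD) => S /ginj ->; apply.
by apply: (ND); exists D.
Qed.
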